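(* Let $H=H(x^1,x^2)$ be a smooth real-valued function on an open subset of $\mathbb{R}^2$, and consider the Hamiltonian system $\frac{dx^1}{dt}=H_2(x^1,x^2)$, $\frac{dx^2}{dt}=-H_1(x^1,x^2)$. The curvature deviation tensor $P_H=(P^i_j)_{i,j=1,2}$ (row index $i$, column index $j$) associated to the second order system obtained by differentiating these equations in $t$, namely $$\frac{d^2x^1}{dt^2}=H_{21}y^1+H_{22}y^2,\qquad \frac{d^2x^2}{dt^2}=-H_{11}y^1-H_{12}y^2,\qquad y^i=\frac{dx^i}{dt},$$ is given, as a function of $(x^1,x^2,y^1,y^2)$, by $$P_H=\frac12\begin{pmatrix}\mathrm{Hess}(H_2)\cdot y & \mathrm{Hess}(-H_1)\cdot y\end{pmatrix}^{t}+\frac14J_H^2,$$ where $y=(y^1,y^2)^t$, the first matrix (before transposition, denoted by the superscript $t$) has columns $\mathrm{Hess}(H_2)\cdot y$ and $\mathrm{Hess}(-H_1)\cdot y$, with $$\mathrm{Hess}(H_2)=\begin{pmatrix}H_{211}&H_{212}\\ H_{212}&H_{222}\end{pmatrix},\quad \mathrm{Hess}(-H_1)=\begin{pmatrix}-H_{111}&-H_{112}\\ -H_{112}&-H_{122}\end{pmatrix},\quad J_H=\begin{pmatrix}H_{21}&H_{22}\\ -H_{11}&-H_{12}\end{pmatrix}.$$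
   Context: Subscripts on $H$ denote partial derivatives: $H_i=\partial H/\partial x^i$, $H_{ij}=\partial^2H/\partial x^i\partial x^j$, $H_{ijk}=\partial^3H/\partial x^i\partial x^j\partial x^k$. Repeated indices are summed. For a system of second order ODEs $\frac{d^2x^i}{dt^2}+2G^i(x,y,t)=0$, $i=1,\dots,n$, with $y^i=dx^i/dt$ and $G^i$ smooth, the nonlinear connection is $N^i_j=\partial G^i/\partial y^j$, the Berwald connection is $G^i_{jl}=\partial N^i_j/\partial y^l$, and the curvature deviation tensor (second KCC invariant) is $$P^i_j=-2\frac{\partial G^i}{\partial x^j}-2G^lG^i_{jl}+y^l\frac{\partial N^i_j}{\partial x^l}+N^i_lN^l_j+\frac{\partial N^i_j}{\partial t},$$ where $x^i,y^i,t$ are treated as independent variables. Here $n=2$ and $G^1=-\frac12(H_{21}y^1+H_{22}y^2)$, $G^2=\frac12(H_{11}y^1+H_{12}y^2)$. *)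

(* Defs.v *)
From HB Require Import structures.
From mathcomp Require Export all_boot all_order all_algebra.
From mathcomp Require Export all_classical all_reals all_analysis.
Export Order.TTheory GRing.Theory Num.Theory.
Export numFieldNormedType.Exports.

Set Implicit Arguments.
Unset Strict Implicit.
Unset Printing Implicit Defensive.

Local Open Scope classical_set_scope.
Local Open Scope ring_scope.

Section Partial.
Context {R : realType} {n : nat}.
Implicit Types (f : 'cV[R]_n -> R) (x : 'cV[R]_n).

Definition basis (i : 'I_n) : 'cV[R]_n := delta_mx i 0.

Definition partial (i : 'I_n) f : 'cV[R]_n -> R := fun x => 'D_(basis i) f x.

(* [pd [:: i; j; k] f] is d^3 f / dx^i dx^j dx^k, written f_ijk:
   the rightmost index is differentiated first. *)
Definition pd (s : seq 'I_n) f : 'cV[R]_n -> R := foldr partial f s.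

(* C^oo on U: the partial derivatives of all orders exist and are continuous
   at every point of U.  The values of f outside U are irrelevant when U is
   open. *)
Definition smooth_on (U : set 'cV[R]_n) f : Prop :=
  forall (s : seq 'I_n) x, U x ->
    {for x, continuous (pd s f)} /\
    forall i : 'I_n, derivable (pd s f) x (basis i).

Definition hessian f x : 'M[R]_n := \matrix_(i, j) pd [:: i; j] f x.

End Partial.

(* KCC objects of the system x'' + 2 G (x, x', t) = 0; in [G x y t] the
   arguments x, y, t are independent variables. *)
Section KCC.
Context {R : realType} {n : nat}.
Variable G : 'cV[R]_n -> 'cV[R]_n -> R -> 'cV[R]_n.
Implicit Types (x y : 'cV[R]_n) (t : R) (i j l : 'I_n).

Definition solves_sode (I : set R) (c : R -> 'cV[R]_n) : Prop :=
  forall t, I t ->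
    derivable c t 1 /\ derivable (derive1 c) t 1 /\
    derive1 (derive1 c) t + 2 *: G (c t) (derive1 c t) t = 0.

Definition nonlinear_connection i j x y t : R :=
  partial j (fun y' => G x y' t i 0) y.

Definition berwald_connection i j l x y t : R :=
  partial l (fun y' => nonlinear_connection i j x y' t) y.

Definition curvature_deviation x y t : 'M[R]_n :=
  \matrix_(i, j)
    (- 2 * partial j (fun x' => G x' y t i 0) x
     - 2 * (\sum_l G x y t l 0 * berwald_connection i j l x y t)
     + \sum_l y l 0 * partial l (fun x' => nonlinear_connection i j x' y t) x
     + \sum_l nonlinear_connection i l x y t * nonlinear_connection l j x y t
     + derive1 (nonlinear_connection i j x y) t).

End KCC.

Section Planar.
Context {R : realType}.

(* The indices 1 and 2 of the plane coordinates x^1, x^2. *)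
Definition i1 : 'I_2 := ord0.
Definition i2 : 'I_2 := ord_max.

Definition col2 (a b : R) : 'cV[R]_2 :=
  \col_(i < 2) if i == i1 then a else b.

Definition mx22 (a b c d : R) : 'M[R]_2 :=
  \matrix_(i < 2, j < 2)
    if i == i1 then (if j == i1 then a else b)
    else (if j == i1 then c else d).

Variable H : 'cV[R]_2 -> R.

Definition hamiltonian_field (x : 'cV[R]_2) : 'cV[R]_2 :=
  col2 (pd [:: i2] H x) (- pd [:: i1] H x).

Definition solves_hamilton (U : set 'cV[R]_2) (I : set R)
    (c : R -> 'cV[R]_2) : Prop :=
  forall t, I t -> U (c t) /\ is_derive t 1 c (hamiltonian_field (c t)).

Definition hamiltonian_G (x y : 'cV[R]_2) (t : R) : 'cV[R]_2 :=
  col2 (- 2^-1 * (pd [:: i2; i1] H x * y i1 0 + pd [:: i2; i2] H x * y i2 0))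
       (2^-1 * (pd [:: i1; i1] H x * y i1 0 + pd [:: i1; i2] H x * y i2 0)).

Definition hamiltonian_J (x : 'cV[R]_2) : 'M[R]_2 :=
  mx22 (pd [:: i2; i1] H x) (pd [:: i2; i2] H x)
       (- pd [:: i1; i1] H x) (- pd [:: i1; i2] H x).

End Planar.

(* Main.v *)
From HB Require Import structures.
Require Import Defs.
From mathcomp Require Import ring.

(** The Hamiltonian system is x' = X(x) with X = (H_2, -H_1), and both halves of
    the result hold for any smooth first order system whose Jacobian is J.

    Differentiating x' = X(x) in t by the chain rule gives x'' = J(x) x'
    ([integral_curve_derive2]), which is x'' + 2 G = 0 for G = - J(x) y / 2. The
    chain rule needs X to be differentiable, whereas smoothness is given by
    continuous partial derivatives; [C1_differentiable] bridges the two.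

    For such a G ([linear_G]), linear in y, the nonlinear connection is - J / 2 and the
    Berwald connection vanishes ([curvature_deviation_linear]). In P the product
    N N contributes J^2 / 4, while the terms in dG/dx and dN/dx contribute
    (X^i_kj - X^i_jk / 2) y^k, that is, half of Hess (X^i) y once second
    derivatives commute ([curvature_deviation_field]).

    Everything else about H itself is the symmetry of its iterated partial
    derivatives ([derive_commute]), a limit of second differences. It identifies
    J_H with the Jacobian of X and puts the Hessians in the stated form. *)

Set Implicit Arguments.
Unset Strict Implicit.
Unset Printing Implicit Defensive.

Local Open Scope classical_set_scope.
Local Open Scope ring_scope.

(** * Mean values and the symmetry of second derivatives *)

Section Directional.
Context {R : realType} {V : normedModType R}.
Implicit Types (f : V -> R) (x z u v : V).

Lemma is_derive_translate f z v w (d : R) :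
  is_derive (z + w) v f d -> is_derive z v (fun p => f (p + w)) d.
Proof.
move=> fd; have e : (fun h : R => h^-1 *: (((fun p => f (p + w)) \o shift z) (h *: v)
    - f (z + w))) = (fun h => h^-1 *: ((f \o shift (z + w)) (h *: v) - f (z + w))).
  by apply/funext => h /=; rewrite addrA.
by split; [rewrite /derivable e; case: fd | rewrite /derive e; case: fd].
Qed.

Lemma is_derive_line f z v (s d : R) :
  is_derive (z + s *: v) v f d -> is_derive s 1 (fun r : R => f (z + r *: v)) d.
Proof.
move=> fd; have e : (fun h : R => h^-1 *: (((fun r : R => f (z + r *: v)) \o shift s)
    (h *: (1 : R)) - f (z + s *: v))) =
  (fun h => h^-1 *: ((f \o shift (z + s *: v)) (h *: v) - f (z + s *: v))).
  apply/funext => h /=; congr (_ *: (f _ - _)).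
  by rewrite /shift /= [h *: 1]mulr1 scalerDl addrCA.
by split; [rewrite /derivable e; case: fd | rewrite /derive e; case: fd].
Qed.

Lemma mean_value_dir f z v (h : R) :
  (forall c : R, `|c| <= `|h| -> derivable f (z + c *: v) v) ->
  exists2 c : R, `|c| <= `|h| & f (z + h *: v) - f z = h * 'D_v f (z + c *: v).
Proof.
move=> df; pose g (r : R) := f (z + r *: v).
have dg (c : R) : `|c| <= `|h| -> is_derive c 1 g ('D_v f (z + c *: v)).
  by move=> /df/derivableP; exact: is_derive_line.
have cg (a b : R) : (forall c, c \in `[a, b] -> `|c| <= `|h|) ->
    {within `[a, b], continuous g}.
  move=> abh; apply: derivable_within_continuous => c /abh/dg.
  by case.
have g0 : g 0 = f z by rewrite /g scale0r addr0.
have [h0|/ltW h0] := leP 0 h.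
  have lehP c : c \in `[0, h] -> `|c| <= `|h|.
    by rewrite in_itv /= => /andP[c0 ch]; rewrite !ger0_norm.
  have [||c /lehP ch e] := @MVT_segment _ g (fun c => 'D_v f (z + c *: v)) 0 h h0.
  - by move=> c /subset_itv_oo_cc/lehP/dg.
  - exact: cg.
  by exists c => //; rewrite -g0 -/(g h) e subr0 mulrC.
have lehP c : c \in `[h, 0] -> `|c| <= `|h|.
  by rewrite in_itv /= => /andP[hc c0]; rewrite !ler0_norm// lerN2.
have [||c /lehP ch e] := @MVT_segment _ g (fun c => 'D_v f (z + c *: v)) h 0 h0.
- by move=> c /subset_itv_oo_cc/lehP/dg.
- exact: cg.
by exists c => //; rewrite -g0 -/(g h) -opprB e; ring.
Qed.

(** Two mean value steps write the second difference as s^2 times the iterated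
    derivative at a point of the small parallelogram spanned by s u and s v;
    continuity of that derivative gives the limit. *)
Lemma cvg_second_difference f x u v :
  (\forall z \near x, derivable f z u) ->
  (\forall z \near x, derivable ('D_u f) z v) ->
  {for x, continuous ('D_v ('D_u f))} ->
  (fun s : R => (s * s)^-1 *
     ((f (x + s *: u + s *: v) - f (x + s *: u)) - (f (x + s *: v) - f x)))
    @ 0^' --> 'D_v ('D_u f) x.
Proof.
move=> dfu dfuv cuv; apply/cvgrPdist_le => e e0.
have /cvgrPdist_le/(_ e e0) ce := cuv.
have /nbhs_ballP[d /= d0 dP] : \forall z \near x,
  [/\ derivable f z u, derivable ('D_u f) z v
    & `|'D_v ('D_u f) x - 'D_v ('D_u f) z| <= e].
  by near=> z; split; near: z.
have inball (s a b : R) : s * (1 + `|u| + `|v|) < d -> `|a| <= s -> `|b| <= s ->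
    ball x d (x + a *: u + b *: v).
  move=> sd as_ bs; have s0 : 0 <= s by rewrite (le_trans _ as_).
  rewrite -ball_normE /= -addrA opprD addrA subrr add0r normrN.
  apply: le_lt_trans sd; apply: le_trans (ler_normD _ _) _.
  rewrite !normrZ -addrA !mulrDr mulr1.
  rewrite -[leLHS]add0r; apply: lerD => //.
  by apply: lerD; apply: ler_wpM2r.
have K0 : 0 < 1 + `|u| + `|v| by rewrite -addrA; apply: ltr_wpDr => //; apply: addr_ge0.
near=> s.
have s0 : s != 0 by near: s; exact: nbhs_dnbhs_neq.
have sd : `|s| * (1 + `|u| + `|v|) < d.
  rewrite -ltr_pdivlMr//.
  by near: s; apply: dnbhs0_lt; rewrite divr_gt0.
(* The first mean value step is for the increment of f along s v, as a function
   of the base point; the second is for 'D_u f. *)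
pose g z := f (z + s *: v) - f z.
have dg (c : R) : `|c| <= `|s| -> is_derive (x + c *: u) u g
    ('D_u f (x + c *: u + s *: v) - 'D_u f (x + c *: u)).
  move=> cs; apply: is_deriveB.
    apply: is_derive_translate; apply: derivableP.
    by have [] := dP _ (inball _ _ _ sd cs (lexx _)).
  apply: derivableP; have := dP _ (inball _ c 0 sd cs _).
  by rewrite normr0 scale0r addr0 => /(_ (normr_ge0 _))[].
have [c /[dup] cs /dg[_ gE] Ec] : exists2 c, `|c| <= `|s| &
    g (x + s *: u) - g x = s * 'D_u g (x + c *: u).
  by apply: mean_value_dir => c /dg[].
have [b bs Eb] := @mean_value_dir ('D_u f) (x + c *: u) v s
  (fun b bs => let: And3 _ H _ := dP _ (inball _ _ _ sd cs bs) in H).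
rewrite -/(g (x + s *: u)) -/(g x) Ec gE Eb mulrA mulrA mulVf ?mulf_neq0// mul1r.
by have [] := dP _ (inball _ _ _ sd cs bs).
Unshelve. all: by end_near. Qed.

(** Schwarz's theorem: the second difference is symmetric in u and v, so its
    limit is both iterated derivatives. *)
Lemma derive_commute f x u v :
  (\forall z \near x, derivable f z u) ->
  (\forall z \near x, derivable f z v) ->
  (\forall z \near x, derivable ('D_u f) z v) ->
  (\forall z \near x, derivable ('D_v f) z u) ->
  {for x, continuous ('D_v ('D_u f))} ->
  {for x, continuous ('D_u ('D_v f))} ->
  'D_v ('D_u f) x = 'D_u ('D_v f) x.
Proof.
move=> du dv duv dvu cuv cvu.
have := cvg_second_difference du duv cuv.
have := cvg_second_difference dv dvu cvu.
rewrite [X in X @ _ --> _ -> _](_ : _ = (fun s : R => (s * s)^-1 *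
     ((f (x + s *: u + s *: v) - f (x + s *: u)) - (f (x + s *: v) - f x)))).
  by move=> c1 c2; exact: cvg_unique c2 c1.
by apply/funext => s; congr (_ * _); rewrite [x + _ + _]addrAC; ring.
Qed.

End Directional.

(** * C^1 functions are differentiable *)

Lemma differentiable_from_increment (R : numFieldType) (V W : normedModType R)
    (f : V -> W) (x : V) (df : {linear V -> W}) : continuous df ->
  (forall e : R, 0 < e -> \forall h \near (0 : V),
    `|f (h + x) - f x - df h| <= e * `|h|) ->
  differentiable f x.
Proof.
move=> cdf fE; have E : f \o shift x = cst (f x) + df +o_ 0 id.
  apply/eqaddoP => e e0; have := fE e e0; apply: filterS => h.
  by rewrite -addrA -opprD.
by apply/diff_locallyP; rewrite (diff_unique cdf E).
Qed.

Section C1.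
Context {R : realType} {n : nat}.
Implicit Types (f : 'cV[R]_n -> R) (x h : 'cV[R]_n).

Lemma cV_normE_le h (r : R) : 0 <= r -> (forall i, `|h i 0| <= r) -> `|h| <= r.
Proof.
move=> r0 hr; rewrite [leLHS]/Num.Def.normr/= mx_normrE (bigmax_le _ r0)//=.
by case=> i j _; rewrite ord1.
Qed.

Lemma cV_coord_le h i : `|h i 0| <= `|h|.
Proof.
rewrite [leRHS]/Num.Def.normr/= mx_normrE.
exact: (le_bigmax _ (fun ij : 'I_n * 'I_1 => `|h ij.1 ij.2|) (i, 0)).
Qed.

(** The increment f (x + h) - f x telescopes along the polygonal path from x to
    x + h that changes one coordinate at a time; on each edge the mean value
    theorem gives a partial derivative at a point within |h| of x. *)
Lemma C1_increment f x :
  (forall i, \forall z \near x, derivable f z (basis i)) ->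
  (forall i, {for x, continuous (partial i f)}) ->
  forall e : R, 0 < e -> \forall h \near (0 : 'cV[R]_n),
    `|f (h + x) - f x - \sum_i h i 0 * partial i f x| <= e * `|h|.
Proof.
move=> df cf e e0.
(* Each of the n edges gets e / (n + 1), which also makes sense for n = 0. *)
have e'0 : 0 < e / n.+1%:R by rewrite divr_gt0.
have /nbhs_ballP[d /= d0 dP] : \forall z \near x, forall i,
    derivable f z (basis i) /\ `|partial i f x - partial i f z| <= e / n.+1%:R.
  apply: (@filter_forall _ _ _ _ (nbhs_filter x)) => i.
  near=> z; split; near: z; first exact: df.
  by have /cvgrPdist_le/(_ _ e'0) := cf i.
apply: filterS (nbhs0_lt d0) => h hd.
(* The vertices of the path, relative to x. *)
pose w k : 'cV[R]_n := \col_i (if (i < k)%N then h i 0 else 0).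
have wS (k : 'I_n) : w k.+1 = w k + h k 0 *: basis k.
  apply/colP => i; rewrite !mxE eqxx andbT ltnS leq_eqVlt -val_eqE /=.
  by case: (ltngtP i k) => [||/val_inj->] /=; rewrite ?mulr0 ?addr0 ?mulr1 ?add0r.
have w0 : w 0%N = 0 by apply/colP => i; rewrite !mxE.
have wn : w n = h by apply/colP => i; rewrite !mxE ltn_ord.
have inball (k : 'I_n) (c : R) : `|c| <= `|h k 0| -> ball x d (x + w k + c *: basis k).
  move=> ck; rewrite -ball_normE /= -addrA opprD addrA subrr add0r normrN.
  apply: le_lt_trans hd; apply: cV_normE_le => // i.
  rewrite !mxE eqxx andbT -val_eqE /=.
  case: (ltngtP i k) => _ /=; rewrite ?mulr0 ?addr0 ?mulr1 ?add0r ?normr0 ?cV_coord_le//.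
  exact: le_trans ck (cV_coord_le _ _).
have -> : f (h + x) - f x = \sum_(k < n) (f (x + w k.+1) - f (x + w k)).
  rewrite -(big_mkord xpredT (fun k => f (x + w k.+1) - f (x + w k))).
  by rewrite telescope_sumr// wn w0 addr0 [h + x]addrC.
rewrite -sumrB; apply: le_trans (ler_norm_sum _ _ _) _.
apply: (@le_trans _ _ (\sum_(k < n) e / n.+1%:R * `|h|)); last first.
  rewrite sumr_const card_ord -[leLHS]mulr_natr mulrAC ler_wpM2r//.
  by rewrite -mulrA ler_piMr ?(ltW e0)// ler_pdivrMl ?mulr1 ?ler_nat.
apply: ler_sum => k _; rewrite wS addrA.
have [c ck ->] := @mean_value_dir _ _ f (x + w k) (basis k) (h k 0)
  (fun c ck => (dP _ (inball k c ck) k).1).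
rewrite -mulrBr normrM mulrC distrC ler_pM ?cV_coord_le//.
by have [] := dP _ (inball k c ck) k.
Unshelve. all: by end_near. Qed.

Lemma C1_differentiable f x :
  (forall i, \forall z \near x, derivable f z (basis i)) ->
  (forall i, {for x, continuous (partial i f)}) ->
  differentiable f x.
Proof.
move=> df cf.
pose L h : R := \sum_i h i 0 * partial i f x.
have linL : linear L.
  move=> a h k; rewrite /L scaler_sumr -big_split; apply: eq_bigr => i _ /=.
  by rewrite !mxE mulrDl -mulrA.
pose Llin := GRing.isLinear.Build _ _ _ _ _ linL.
pose Ls : {linear 'cV[R]_n -> R} := HB.pack L Llin.
have cL : continuous L.
  apply: (@continuous_big R _ _ _ xpredT) => [|i _ h]; first exact: (@add_continuous R).
  have ci : (fun k : 'cV[R]_n => k i 0) k @[k --> h] --> h i 0.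
    exact: coord_continuous.
  exact: cvgMr_tmp ci.
apply: (@differentiable_from_increment _ _ _ f x Ls cL) => e e0.
exact: C1_increment df cf e e0.
Qed.

Lemma derive_partial f x h : differentiable f x ->
  'D_h f x = \sum_i h i 0 * partial i f x.
Proof.
move=> df; rewrite deriveE//.
rewrite [in LHS](_ : h = \sum_i h i 0 *: basis i); last first.
  by rewrite {1}(matrix_sum_delta h); apply: eq_bigr => i _; rewrite big_ord1.
rewrite linear_sum; apply: eq_bigr => i _.
by rewrite linearZ /= /partial deriveE.
Qed.

Lemma is_derive_comp_curve f (c : R -> 'cV[R]_n) (t : R) d :
  differentiable f (c t) -> is_derive t 1 c d ->
  is_derive t 1 (f \o c) (\sum_i d i 0 * partial i f (c t)).
Proof.
move=> df [dc dE].
have dc' : differentiable c t by exact/derivable1_diffP.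
have dfc : differentiable (f \o c) t by exact: differentiable_comp.
apply: DeriveDef; first exact/derivable1_diffP.
by rewrite deriveE// diff_comp//= -deriveE// -deriveE// dE derive_partial.
Qed.

End C1.

(** * Calculus of smooth functions on an open set *)

Lemma near_eq_continuous_at (S T : topologicalType) (f g : S -> T) (x : S) :
  {near x, f =1 g} -> {for x, continuous f} -> {for x, continuous g}.
Proof.
move=> fg cf; rewrite /prop_for /continuous_at -(nbhs_singleton fg).
by apply: cvg_trans cf; apply: near_eq_cvg.
Qed.

Section Smooth.
Context {R : realType} {n : nat}.
Variable U : set 'cV[R]_n.
Hypothesis openU : open U.
Implicit Types (f g : 'cV[R]_n -> R) (x : 'cV[R]_n) (s : seq 'I_n).

Lemma near_open (P : 'cV[R]_n -> Prop) x : U x ->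
  (forall z, U z -> P z) -> \forall z \near x, P z.
Proof. by move=> Ux UP; apply: filterS UP (open_nbhs_nbhs (conj openU Ux)). Qed.

Lemma pd_cat s s' f : pd s (pd s' f) = pd (s ++ s') f.
Proof. by rewrite /pd foldr_cat. Qed.

Lemma smooth_on_pd s f : smooth_on U f -> smooth_on U (pd s f).
Proof. by move=> sf s' x Ux; rewrite pd_cat; exact: sf. Qed.

Lemma smooth_on_differentiable f x : smooth_on U f -> U x -> differentiable f x.
Proof.
move=> sf Ux; apply: C1_differentiable => i.
  by apply: near_open Ux _ => z Uz; exact: (sf [::] z Uz).2.
exact: (sf [:: i] x Ux).1.
Qed.

Lemma eq_pd s f g : (forall z, U z -> f z = g z) ->
  forall z, U z -> pd s f z = pd s g z.
Proof.
move=> fg; elim: s => [|i s IH] z Uz /=; first exact: fg.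
by apply: near_eq_derive; exact: near_open Uz IH.
Qed.

Lemma pd_swap i j f x : smooth_on U f -> U x -> pd [:: i; j] f x = pd [:: j; i] f x.
Proof.
move=> sf Ux; apply: derive_commute.
- by apply: near_open Ux _ => z Uz; exact: (sf [::] z Uz).2.
- by apply: near_open Ux _ => z Uz; exact: (sf [::] z Uz).2.
- by apply: near_open Ux _ => z Uz; exact: (sf [:: j] z Uz).2.
- by apply: near_open Ux _ => z Uz; exact: (sf [:: i] z Uz).2.
- exact: (sf [:: i; j] x Ux).1.
- exact: (sf [:: j; i] x Ux).1.
Qed.

(** Adjacent differentiations commute anywhere in the word: those performed
    before them leave a smooth function, those performed after them only see its
    values on the open set U. *)
Lemma pd_exchange s i j s' f x : smooth_on U f -> U x ->
  pd (s ++ [:: i, j & s']) f x = pd (s ++ [:: j, i & s']) f x.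
Proof.
move=> sf Ux; rewrite -(pd_cat s (i :: j :: s')) -(pd_cat s (j :: i :: s')).
apply: eq_pd Ux => z Uz.
rewrite -(pd_cat [:: i; j] s') -(pd_cat [:: j; i] s').
exact: pd_swap (smooth_on_pd s' sf) Uz.
Qed.

(** The iterated derivatives of f off U are unconstrained, so a pointwise rule on
    U passes to the next derivative only because U is open. *)
Lemma pdN s f : smooth_on U f -> forall z, U z -> pd s (fun z => - f z) z = - pd s f z.
Proof.
move=> sf; elim: s => [//|i s IH] z Uz /=.
rewrite /partial (near_eq_derive _ (near_open Uz IH)).
by rewrite (@deriveN _ _ _ (pd s f))//; exact: (sf s z Uz).2.
Qed.

Lemma smooth_onN f : smooth_on U f -> smooth_on U (fun z => - f z).
Proof.
move=> sf s x Ux; have nE : {near x, (fun z => - pd s f z) =1 pd s (fun z => - f z)}.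
  by apply: near_open Ux _ => z Uz; rewrite pdN.
have [cs ds] := sf s x Ux; split => [|i].
  by apply: near_eq_continuous_at nE _; apply: continuousN.
by apply: near_eq_derivable nE _; exact: derivableN (ds i).
Qed.

End Smooth.

(** * Systems obtained by differentiating a first order system *)

Section Field.
Context {R : realType} {n : nat}.
Implicit Types (X : 'cV[R]_n -> 'cV[R]_n) (x y : 'cV[R]_n).

Definition jacobian_mx X x : 'M[R]_n :=
  \matrix_(i, j) partial j (fun z => X z i 0) x.

Definition smooth_field (U : set 'cV[R]_n) X :=
  forall i, smooth_on U (fun z => X z i 0).

(** Along an integral curve c' = X(c) near t, so the chain rule computes c''. *)
Lemma integral_curve_derive2 (U : set 'cV[R]_n) (I : set R) X (c : R -> 'cV[R]_n) :
  open U -> smooth_field U X -> open I ->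
  (forall t, I t -> U (c t) /\ is_derive t 1 c (X (c t))) ->
  forall t, I t ->
    is_derive t 1 (derive1 c) (jacobian_mx X (c t) *m derive1 c t).
Proof.
move=> oU sX oI cX t It; have [Uct dct] := cX t It.
have c1E s : I s -> derive1 c s = X (c s).
  by move=> /cX[_ [_ <-]]; rewrite derive1E.
have nE : \near t, X (c t) = derive1 c t.
  by apply: filterS (open_nbhs_nbhs (conj oI It)) => s /c1E.
apply: near_eq_is_derive nE _.
have dXi i : is_derive t 1 (fun s => X (c s) i 0)
    (\sum_j X (c t) j 0 * partial j (fun z => X z i 0) (c t)).
  by apply: (@is_derive_comp_curve _ _ (fun z => X z i 0)) => //;
    exact: smooth_on_differentiable oU _ _ (sX i) Uct.
have dX : derivable (X \o c) t 1.
  by apply/derivable_mxP => i j; rewrite ord1; have [] := dXi i.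
apply: DeriveDef => //.
rewrite (derive_mx dX); apply/matrixP => i j; rewrite ord1 !mxE.
have [_ /= ->] := dXi i; apply: eq_bigr => k _.
by rewrite mxE mulrC c1E.
Qed.

Lemma eq_partial i (f g : 'cV[R]_n -> R) x : f =1 g -> partial i f x = partial i g x.
Proof. by move/funext->. Qed.

(** Read off, entry by entry, from the derivative of the identity. *)
Lemma is_derive_coord k y v : is_derive y v (fun y' : 'cV[R]_n => y' k 0) (v k 0).
Proof.
have did : derivable (@id 'cV[R]_n) y v by exact: derivable_id.
split; first exact: (derivable_mxP _ _ _).1 did k 0.
by have /matrixP/(_ k 0) := derive_mx did; rewrite derive_id mxE.
Qed.

Lemma is_derive_lincomb (V : normedModType R) (a : 'I_n -> V -> R)
    (da b : 'I_n -> R) z v :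
  (forall k, is_derive z v (a k) (da k)) ->
  is_derive z v (fun p => \sum_k a k p * b k) (\sum_k da k * b k).
Proof.
move=> dak.
have := @is_derive_sum _ _ _ n (fun k => b k \*: a k) z v (fun k => b k *: da k)
  (fun k => is_deriveZ (b k) (dak k)).
have -> : \sum_k b k \*: a k = (fun p => \sum_k a k p * b k).
  by apply/funext => p; rewrite fct_sumE; apply: eq_bigr => k _; rewrite mulrC.
by under eq_bigr do rewrite /GRing.scale /= mulrC.
Qed.

(** With this G, the system x'' + 2 G = 0 reads x'' = J(x) x'. *)
Definition linear_G (J : 'cV[R]_n -> 'M[R]_n) (x y : 'cV[R]_n) (_ : R) : 'cV[R]_n :=
  - 2^-1 *: (J x *m y).

Lemma linear_GE J x y t i : linear_G J x y t i 0 = \sum_k J x i k * (- 2^-1 * y k 0).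
Proof. by rewrite !mxE mulr_sumr; apply: eq_bigr => k _; rewrite mulrCA. Qed.

Lemma nonlinear_connection_linear J i j x y t :
  nonlinear_connection (linear_G J) i j x y t = - 2^-1 * J x i j.
Proof.
have [_ E] := @is_derive_lincomb _ (fun k (w : 'cV[R]_n) => w k 0)
  (fun k => basis j k 0) (fun k => - 2^-1 * J x i k) y (basis j)
  (fun k => is_derive_coord k y (basis j)).
transitivity (\sum_k (basis j : 'cV[R]_n) k 0 * (- 2^-1 * J x i k)).
  rewrite -E; apply: eq_partial => w.
  rewrite linear_GE; apply: eq_bigr => k _.
  by rewrite mulrCA [J x i k * _]mulrC mulrCA.
rewrite (bigD1 j)//= big1 ?addr0 => [|k kj].
  by rewrite mxE !eqxx mul1r.
by rewrite mxE (negPf kj) mul0r.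
Qed.

Lemma berwald_connection_linear J i j l x y t :
  berwald_connection (linear_G J) i j l x y t = 0.
Proof.
apply: etrans (derive_cst (- 2^-1 * J x i j) y (basis l)).
by apply: eq_partial => w; exact: nonlinear_connection_linear.
Qed.

(** The nonlinear connection -J/2 depends on x alone, so the Berwald connection
    and the time derivative vanish, and the product term becomes J^2/4. *)
Lemma curvature_deviation_linear (J : 'cV[R]_n -> 'M[R]_n) x y t :
  (forall i k l, derivable (fun z => J z i k) x (basis l)) ->
  curvature_deviation (linear_G J) x y t =
  \matrix_(i, j) (\sum_k partial j (fun z => J z i k) x * y k 0
                  - 2^-1 * \sum_l y l 0 * partial l (fun z => J z i j) x)
  + 4^-1 *: (J x *m J x).
Proof.
move=> dJ; apply/matrixP => i j; rewrite [LHS]mxE ![in RHS]mxE.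
set S1 := \sum_k partial j _ x * _; set S2 := \sum_l _ * partial l (fun z => J z i j) x.
set S3 := \sum_l J x i l * J x l j.
(* The five terms of P, in the order of its definition. *)
transitivity (- 2 * (- 2^-1 * S1) - 2 * 0 + - 2^-1 * S2 + 4^-1 * S3 + 0); last by field.
congr (_ * _ - _ * _ + _ + _ + _).
- have [_ E] := @is_derive_lincomb _ (fun k z => J z i k)
    (fun k => partial j (fun z => J z i k) x) (fun k => - 2^-1 * y k 0) x (basis j)
    (fun k => derivableP (dJ i k j)).
  rewrite mulr_sumr; under [RHS]eq_bigr do rewrite mulrCA.
  by rewrite -E; apply: eq_partial => z; rewrite linear_GE.
- by apply: big1 => l _; rewrite berwald_connection_linear mulr0.
- rewrite mulr_sumr; apply: eq_bigr => l _; rewrite mulrCA; congr (_ * _).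
  have [_ E] := is_deriveZ (- 2^-1) (derivableP (dJ i j l)).
  apply: etrans E; apply: eq_partial => z.
  exact: nonlinear_connection_linear.
- by rewrite mulr_sumr; apply: eq_bigr => l _; rewrite !nonlinear_connection_linear; field.
- apply: etrans (derive1_cst (- 2^-1 * J x i j) t); congr (derive1 _ t).
  by apply/funext => t'; exact: nonlinear_connection_linear.
Qed.

(** When J is the Jacobian of X, the term from dG/dx is the sum of X^i_kj y^k and
    the term from dN/dx is minus half the sum of X^i_jk y^k. By the symmetry of
    second derivatives they add up to half of Hess (X^i) y.

    J need only agree with the Jacobian on U, so that it may be written with
    mixed derivatives in another order. *)
Lemma curvature_deviation_field (U : set 'cV[R]_n) X (J : 'cV[R]_n -> 'M[R]_n) x y t :
  open U -> smooth_field U X -> (forall z, U z -> J z = jacobian_mx X z) -> U x ->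
  curvature_deviation (linear_G J) x y t =
  2^-1 *: (\matrix_(i, j) (hessian (fun z => X z i 0) x *m y) j 0)
  + 4^-1 *: (J x *m J x).
Proof.
move=> oU sX JE Ux.
have nJ i k : \near x, J x i k = partial k (fun z => X z i 0) x.
  by apply: (near_open oU Ux) => z Uz; rewrite JE// mxE.
have dJ i k l : partial l (fun z => J z i k) x = pd [:: l; k] (fun z => X z i 0) x.
  exact: near_eq_derive (nJ i k).
rewrite curvature_deviation_linear; last first.
  move=> i k l; apply: (@near_eq_derivable _ _ _ (pd [:: k] (fun z => X z i 0))).
    by apply: filterS (nJ i k) => z ->.
  exact: (sX i [:: k] x Ux).2.
congr (_ + _); apply/matrixP => i j; rewrite !mxE mulr_sumr -sumrB mulr_sumr.
apply: eq_bigr => k _; rewrite mxE !dJ (pd_swap oU k j (sX i) Ux).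
by field.
Qed.

End Field.

(** * The Hamiltonian case *)

Section Planar.
Context {R : realType}.

Lemma ord2_ind (P : 'I_2 -> Prop) : P i1 -> P i2 -> forall i, P i.
Proof.
move=> P1 P2 [[|[|//]] lti].
  by rewrite (_ : Ordinal lti = i1)//; exact: val_inj.
by rewrite (_ : Ordinal lti = i2)//; exact: val_inj.
Qed.

Lemma mx22P (M : 'M[R]_2) a b c d :
  M i1 i1 = a -> M i1 i2 = b -> M i2 i1 = c -> M i2 i2 = d -> M = mx22 a b c d.
Proof.
by move=> Ma Mb Mc Md; apply/matrixP; apply: ord2_ind; apply: ord2_ind; rewrite [RHS]mxE.
Qed.

Lemma scale_mx22_mulmx (k a b c d : R) (y : 'cV[R]_2) :
  - k *: (mx22 a b (- c) (- d) *m y) =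
  col2 (- k * (a * y i1 0 + b * y i2 0)) (k * (c * y i1 0 + d * y i2 0)).
Proof.
have l2 : lift ord0 ord0 = i2 by exact: val_inj.
by apply/colP; apply: ord2_ind; rewrite !mxE !big_ord_recl big_ord0 l2 !mxE /=; ring.
Qed.

Lemma tr_row_mx_cols (u v : 'cV[R]_2) j :
  (row_mx u v)^T i1 j = u j 0 /\ (row_mx u v)^T i2 j = v j 0.
Proof.
rewrite ![(_^T) _ _]mxE -(row_mxEl u v j 0) -(row_mxEr u v j 0).
by split; congr (row_mx u v j _); exact: val_inj.
Qed.

End Planar.

Section Hamiltonian.
Context {R : realType} (U : set 'cV[R]_2) (H : 'cV[R]_2 -> R).
Hypotheses (openU : open U) (smoothH : smooth_on U H).

Lemma hamiltonian_field1 : (fun z => hamiltonian_field H z i1 0) = pd [:: i2] H.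
Proof. by apply/funext => z; rewrite mxE. Qed.

Lemma hamiltonian_field2 :
  (fun z => hamiltonian_field H z i2 0) = (fun z => - pd [:: i1] H z).
Proof. by apply/funext => z; rewrite mxE. Qed.

Lemma smooth_hamiltonian_field : smooth_field U (hamiltonian_field H).
Proof.
apply: ord2_ind; first by rewrite hamiltonian_field1; exact: smooth_on_pd.
rewrite hamiltonian_field2.
exact: (smooth_onN openU (smooth_on_pd [:: i1] smoothH)).
Qed.

(** J_H has H_21 and -H_12 on its diagonal, where the Jacobian of (H_2, -H_1)
    has H_12 and -H_21: the two agree on U by Schwarz's theorem. *)
Lemma hamiltonian_JE z : U z -> hamiltonian_J H z = jacobian_mx (hamiltonian_field H) z.
Proof.
move=> Uz; have sH1 := smooth_on_pd [:: i1] smoothH.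
apply/esym/mx22P; rewrite mxE ?hamiltonian_field1 ?hamiltonian_field2.
- exact: (pd_swap openU i1 i2 smoothH Uz).
- by [].
- exact: (pdN openU [:: i1] sH1 Uz).
- have N1 : pd [:: i2] (fun w => - pd [:: i1] H w) z = - pd [:: i1; i2] H z.
    by rewrite (pdN openU [:: i2] sH1 Uz) pd_cat (pd_swap openU i2 i1 smoothH Uz).
  exact: N1.
Qed.

Lemma hamiltonian_GE : hamiltonian_G H = linear_G (hamiltonian_J H).
Proof.
apply/funext => x; apply/funext => y; apply/funext => t.
by rewrite /linear_G /hamiltonian_J scale_mx22_mulmx.
Qed.

End Hamiltonian.

Theorem proposition5p1 (R : realType) (U : set 'cV[R]_2) (H : 'cV[R]_2 -> R)
    (openU : open U) (smoothH : smooth_on U H) :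
  (* differentiating Hamilton's equations in t gives x'' + 2 G(x, x') = 0 *)
  (forall (I : set R) (c : R -> 'cV[R]_2), open I ->
     solves_hamilton H U I c -> solves_sode (hamiltonian_G H) I c) /\
  (forall (x y : 'cV[R]_2) (t : R), U x ->
     let H1 := pd [:: i1] H in
     let H2 := pd [:: i2] H in
     [/\ hessian H2 x =
           mx22 (pd [:: i2; i1; i1] H x) (pd [:: i2; i1; i2] H x)
                (pd [:: i2; i1; i2] H x) (pd [:: i2; i2; i2] H x),
         hessian (fun z => - H1 z) x =
           mx22 (- pd [:: i1; i1; i1] H x) (- pd [:: i1; i1; i2] H x)
                (- pd [:: i1; i1; i2] H x) (- pd [:: i1; i2; i2] H x)
       & curvature_deviation (hamiltonian_G H) x y t =
           2^-1 *: (row_mx (hessian H2 x *m y)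
                           (hessian (fun z => - H1 z) x *m y))^T
           + 4^-1 *: (hamiltonian_J H x ^+ 2)]).
Proof.
have JE := hamiltonian_JE openU smoothH.
have sX := smooth_hamiltonian_field openU smoothH.
split=> [I c oI cH t It|x y t Ux H1 H2].
  have [Uct [dc _]] := cH t It.
  have [dc' c2] := integral_curve_derive2 openU sX oI cH It.
  split; [exact: dc|split; first exact: dc'].
  rewrite {1}derive1E c2 hamiltonian_GE /linear_G JE// scalerA mulrN divff// scaleN1r.
  exact: subrr.
have sH1 := smooth_on_pd [:: i1] smoothH.
have swap i j k : pd [:: i; j; k] H x = pd [:: j; i; k] H x.
  exact: (pd_exchange openU [::] i j [:: k] smoothH Ux).
have swap' i j k : pd [:: i; j; k] H x = pd [:: i; k; j] H x.
  exact: (pd_exchange openU [:: i] j k [::] smoothH Ux).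
have H2E i j : hessian H2 x i j = pd [:: i; j; i2] H x by rewrite mxE pd_cat.
have H1E i j : hessian (fun z => - H1 z) x i j = - pd [:: i; j; i1] H x.
  by rewrite mxE (pdN openU [:: i; j] sH1 Ux) pd_cat.
split.
- apply: mx22P; rewrite H2E.
  + by rewrite (swap' i1 i1 i2) (swap i1 i2 i1).
  + by rewrite (swap i1 i2 i2).
  + by [].
  + by [].
- apply: mx22P; rewrite H1E.
  + by [].
  + by rewrite (swap' i1 i2 i1).
  + by rewrite (swap i2 i1 i1) (swap' i1 i2 i1).
  + by rewrite (swap' i2 i2 i1) (swap i2 i1 i2).
- rewrite hamiltonian_GE (curvature_deviation_field _ _ openU sX JE Ux) expr2.
  have tr := tr_row_mx_cols (hessian H2 x *m y) (hessian (fun z => - H1 z) x *m y).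
  congr (_ *: _ + _); apply/matrixP; apply: ord2_ind => j; rewrite [LHS]mxE.
    by rewrite hamiltonian_field1 (tr j).1.
  by rewrite hamiltonian_field2 (tr j).2.
Qed.
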